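(* Let $\alpha\in[0,1]$, $s\in[0,1]$, $p_0\in[0,1]$ and $\mu_2>0$. With $\hat a,\hat b,\hat c$ as defined in the context, $$\lim_{\mu_1\to+0}\hat c(\mu_1,\mu_2)=(1-s)\alpha+\frac{p_0}{2},\qquad \lim_{\mu_1\to+0}\hat b(\mu_1)=s\alpha+\frac{p_0}{2},\qquad \lim_{\mu_1\to+0}\hat a(\mu_1,\mu_2)=\alpha+p_0.$$
   Context: Parameters: $\alpha$ (total transmission), $s$ (error due to the optical system), $p_0$ (detection rate of the vacuum pulse). For $0<\mu_1<\mu_2$ define $$\hat a(\mu_1,\mu_2)=\frac{\mu_2^2e^{\mu_1}\big((1-e^{-\alpha\mu_1})+p_0(1-e^{-\mu_1})\big)-\mu_1^2e^{\mu_2}\big((1-e^{-\alpha\mu_2})+p_0(1-e^{-\mu_2})\big)}{\mu_1\mu_2(\mu_2-\mu_1)},$$ $$\hat b(\mu_1)=\frac{s(1-e^{-\alpha\mu_1})e^{\mu_1}+\frac{p_0}{2}(e^{\mu_1}-1)}{\mu_1},$$ $$\hat c(\mu_1,\mu_2)=\frac{\mu_2^2e^{\mu_1}\big((1-s)(1-e^{-\alpha\mu_1})+\frac{p_0}{2}(1-e^{-\mu_1})\big)-\mu_1^2e^{\mu_2}\big((1-s)(1-e^{-\alpha\mu_2})+\frac{p_0}{2}(1-e^{-\mu_2})\big)}{\mu_1\mu_2(\mu_2-\mu_1)}.$$ *)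

(* Defs.v *)
From mathcomp Require Import all_boot all_order all_algebra.
From mathcomp Require Import all_classical all_reals all_analysis.

Set Implicit Arguments.
Unset Strict Implicit.
Unset Printing Implicit Defensive.

Import Order.TTheory GRing.Theory Num.Theory.
Import numFieldNormedType.Exports.

Local Open Scope ring_scope.

(* alpha: total transmission; s: error due to the optical system;
   p0: detection rate of the vacuum pulse.  The formulas are meant for
   0 < mu1 < mu2; elsewhere the denominators may vanish. *)

Definition a_hat (R : realType) (alpha p0 mu1 mu2 : R) : R :=
  (mu2 ^+ 2 * expR mu1
     * ((1 - expR (- (alpha * mu1))) + p0 * (1 - expR (- mu1)))
   - mu1 ^+ 2 * expR mu2
     * ((1 - expR (- (alpha * mu2))) + p0 * (1 - expR (- mu2))))
  / (mu1 * mu2 * (mu2 - mu1)).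

Definition b_hat (R : realType) (alpha s p0 mu1 : R) : R :=
  (s * (1 - expR (- (alpha * mu1))) * expR mu1 + p0 / 2 * (expR mu1 - 1))
  / mu1.

Definition c_hat (R : realType) (alpha s p0 mu1 mu2 : R) : R :=
  (mu2 ^+ 2 * expR mu1
     * ((1 - s) * (1 - expR (- (alpha * mu1))) + p0 / 2 * (1 - expR (- mu1)))
   - mu1 ^+ 2 * expR mu2
     * ((1 - s) * (1 - expR (- (alpha * mu2))) + p0 / 2 * (1 - expR (- mu2))))
  / (mu1 * mu2 * (mu2 - mu1)).

(* Main.v *)
(* Both a_hat and c_hat have the shape
     (m^2 e^x g(x) - x^2 e^m g(m)) / (x m (m - x)),
   with g(x) = u (1 - e^(-alpha x)) + v (1 - e^(-x)), while b_hat is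
   e^x g(x) / x.  Cancelling x leaves functions of g(x) / x, which tends
   to g'(0) = u alpha + v. *)
Require Import Defs.
From mathcomp Require Import all_boot all_order all_algebra.
From mathcomp Require Import all_classical all_reals all_analysis.
From mathcomp Require Import ring.
Import Order.TTheory GRing.Theory Num.Theory.
Import numFieldNormedType.Exports.
Local Open Scope classical_set_scope.
Local Open Scope ring_scope.

(** Up to sign this is the difference quotient at 0 of the map sending [x] to [expR (- (a * x))],
    whose derivative there is [- a]. *)
Lemma cvg_one_sub_expRN_div (R : realType) (a : R) :
  (1 - expR (- (a * x))) / x @[x --> 0^'+] --> a.
Proof.
have : is_derive (0 : R) (1 : R) (fun x : R => expR (- (a * x))) (- a).
  by apply: is_derive_eq; rewrite mulr0 oppr0 expR0 /GRing.scale /=; ring.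
case; rewrite /derivable /derive; set q := (q in q @ _) => dq Dq.
(* Derivability gives the limit of [q] along the punctured neighbourhood of 0; the right-hand filter
   is finer and inherits it. *)
have right_dnbhs : (0 : R)^'+ --> (0 : R)^'.
  by move=> A; apply: (@filterS _ (nbhs 0)) => x Ax x0; apply: Ax; rewrite gt_eqF.
have /cvgN : q h @[h --> 0^'+] --> - a.
  by rewrite -Dq; exact: cvg_trans (cvg_app q right_dnbhs) dq.
rewrite opprK; apply: cvg_trans; apply: near_eq_cvg; near=> x.
rewrite /q opprfctE /=.
by rewrite addr0 mulr0 oppr0 expR0 /GRing.scale /= mulr1; ring.
Unshelve. all: by end_near. Qed.

Lemma cvg_expR_at_right0 (R : realType) : expR x @[x --> (0 : R)^'+] --> (1 : R).
Proof.
rewrite -[X in _ --> X]expR0; apply: cvg_at_right_filter.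
exact: continuous_expR.
Qed.

(** A linear combination of two instances of the previous limit, with rates [alpha] and [1]. *)
Lemma cvg_detection_rate {R : realType} (alpha u v : R) :
  (u * (1 - expR (- (alpha * x))) + v * (1 - expR (- x))) / x
    @[x --> 0^'+] --> u * alpha + v.
Proof.
have cvg_lin : u * ((1 - expR (- (alpha * x))) / x)
    + v * ((1 - expR (- (1 * x))) / x) @[x --> 0^'+] --> u * alpha + v * 1.
  by apply: cvgD; apply: cvgM (cvg_cst _) _; apply: cvg_one_sub_expRN_div.
rewrite -[X in _ --> _ + X]mulr1; apply: cvg_trans cvg_lin.
by apply: near_eq_cvg; near=> x; rewrite mul1r; ring.
Unshelve. all: by end_near. Qed.

(** After cancelling [x], the value [g m] survives only in a constant multiplied by [x], so the
    second pulse drops out of the limit. *)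
Lemma cvg_two_decoy_quotient {R : realType} [g : R -> R] [l m : R] :
  0 < m -> g x / x @[x --> 0^'+] --> l ->
  (m ^+ 2 * expR x * g x - x ^+ 2 * expR m * g m) / (x * m * (m - x))
    @[x --> 0^'+] --> l.
Proof.
move=> m0 gl; set K := expR m * g m.
have x0 : x @[x --> (0 : R)^'+] --> (0 : R) by exact: cvg_at_right_filter.
(* [l] is spelled out as the cancelled quotient with [x], [expR x] and [g x / x] replaced by their
   limits, so that the limit laws apply factor by factor. *)
have -> : l = (m ^+ 2 * 1 * l - 0 * K) / (m * (m - 0)).
  by field; rewrite gt_eqF.
suff : (m ^+ 2 * expR x * (g x / x) - x * K) / (m * (m - x)) @[x --> 0^'+] -->
       (m ^+ 2 * 1 * l - 0 * K) / (m * (m - 0)).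
  apply: cvg_trans; apply: near_eq_cvg; near=> x.
  have x_neq0 : x != 0 by rewrite gt_eqF.
  (* Cancelling needs [x < m], which holds close enough to 0 since [0 < m]. *)
  have mx_neq0 : m - x != 0.
    by rewrite subr_eq0 gt_eqF//; near: x; exact: nbhs_right_lt.
  by rewrite /K; field; rewrite mx_neq0 x_neq0 gt_eqF.
apply: cvgM.
  apply: cvgB; last exact: cvgM x0 (cvg_cst _).
  by apply: cvgM gl; apply: cvgM (cvg_cst _) _; exact: cvg_expR_at_right0.
apply: cvgV; first by rewrite subr0 mulf_neq0// gt_eqF.
by apply: cvgM (cvg_cst _) _; exact: cvgB (cvg_cst _) x0.
Unshelve. all: by end_near. Qed.

Theorem lemma3 (R : realType) (alpha s p0 mu2 : R)
  (halpha : 0 <= alpha <= 1) (hs : 0 <= s <= 1) (hp0 : 0 <= p0 <= 1)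
  (hmu2 : 0 < mu2) :
  [/\ c_hat alpha s p0 mu1 mu2 @[mu1 --> 0^'+] --> (1 - s) * alpha + p0 / 2,
      b_hat alpha s p0 mu1 @[mu1 --> 0^'+] --> s * alpha + p0 / 2
    & a_hat alpha p0 mu1 mu2 @[mu1 --> 0^'+] --> alpha + p0].
Proof.
split.
(* Here [u = 1 - s] and [v = p0 / 2]. *)
- exact: cvg_two_decoy_quotient hmu2 (cvg_detection_rate _ _ _).
- rewrite -[X in _ --> X]mul1r.
  apply: cvg_trans (cvgM (cvg_expR_at_right0 R)
                         (cvg_detection_rate alpha s (p0 / 2))).
  (* With [expR (- x)] as an inverse, [field] sees that [expR x * (1 - expR (- x))] is
     [expR x - 1]. *)
  apply: near_eq_cvg; near=> x; rewrite /b_hat /= !expRN; field.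
  by rewrite !gt_eqF ?expR_gt0.
(* Here [u = 1] and [v = p0]. *)
- rewrite -[alpha in X in _ --> X]mul1r.
  apply: cvg_trans (cvg_two_decoy_quotient hmu2 (cvg_detection_rate alpha 1 p0)).
  by apply: near_eq_cvg; near=> x; rewrite /a_hat !mul1r.
Unshelve. all: by end_near. Qed.
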